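(* Fix sequences $s_n\in 2^n$ (for $n\in\mathbb{N}$) such that for every $s\in 2^{<\mathbb{N}}$ there exists $n\in\mathbb{N}$ for which $s_n$ extends $s$, and let $\mathbb{G}_0$ be the digraph on $2^{\mathbb{N}}$ given by $$\mathbb{G}_0=\{(s_n\cdot(0)\cdot c,\ s_n\cdot(1)\cdot c) \mid c\in 2^{\mathbb{N}},\ n\in\mathbb{N}\},$$ where $\cdot$ denotes concatenation of sequences. Suppose that $X$ is a Hausdorff space, $G$ is an analytic digraph on $X$, and $R$ is a reflexive $G_\delta$ binary relation on $X$. Then at least one of the following holds: (1) For every $R$-clique $Y\subseteq X$, there is an $\mathbb{N}$-coloring of $G\upharpoonright Y$. (2) There is a continuous homomorphism $\phi\colon 2^{\mathbb{N}}\to X$ from $\mathbb{G}_0$ to $G$ for which $\phi(2^{\mathbb{N}})$ is an $R$-clique.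
   Context: $2^{\mathbb{N}}$ and $\mathbb{N}^{\mathbb{N}}$ carry the product topologies of discrete spaces; $2^n$ is the set of binary sequences of length $n$, $2^{<\mathbb{N}}=\bigcup_{n\in\mathbb{N}}2^n$, $(i)$ is the length-one sequence with value $i$, and $\cdot$ denotes concatenation. A topological space is analytic if it is a continuous image of a closed subset of $\mathbb{N}^{\mathbb{N}}$ (so the empty space is analytic); a binary relation on $X$ is analytic if it is analytic as a subspace of $X\times X$, and $G_\delta$ if it is a countable intersection of open subsets of $X\times X$. A digraph on a set $X$ is an irreflexive binary relation on $X$. $G\upharpoonright Y$ denotes $G\cap(Y\times Y)$, viewed as a digraph on $Y$. An $I$-coloring of a digraph $G$ on $X$ is a function $c\colon X\to I$ such that $c(x)\neq c(y)$ for all $(x,y)\in G$ (no definability is required). A homomorphism from a binary relation $R$ on $X$ to a binary relation $S$ on $Y$ is a function $\phi\colon X\to Y$ such that $(\phi(x),\phi(x'))\in S$ for all $(x,x')\in R$. A set $Y\subseteq X$ is an $R$-clique if $x\mathrel{R}y$ for all distinct $x,y\in Y$. *)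

(* Defs.v *)
From mathcomp Require Import all_boot.
From mathcomp Require Import all_classical.
From mathcomp Require Import topology borel_hierarchy cantor.

Set Implicit Arguments.
Unset Strict Implicit.
Unset Printing Implicit Defensive.

Local Open Scope classical_set_scope.

Definition baire_space : topologicalType := {ptws nat -> nat}.

(* The domain of f is the subtype C rather than the whole Baire space, so that
   the empty space is analytic. *)
Definition analytic_space (T : topologicalType) : Prop :=
  exists (C : set baire_space) (f : C -> T),
    [/\ closed C, continuous f & range f = [set: T]].

(* Binary relations on X are elements of set (X * X). *)

(* The coercion set_type turns R into a type with the subspace topology. *)
Definition analytic_relation (X : topologicalType) (R : set (X * X)) : Prop :=
  analytic_space R.

Definition reflexive_relation (X : Type) (R : set (X * X)) : Prop :=
  forall x, R (x, x).

Definition digraph (X : Type) (G : set (X * X)) : Prop :=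
  forall x, ~ G (x, x).

Definition restriction (X : Type) (G : set (X * X)) (Y : set X) : set (Y * Y) :=
  [set p | G (val p.1, val p.2)].
Arguments restriction {X} G Y _.

Definition coloring (X I : Type) (G : set (X * X)) (c : X -> I) : Prop :=
  forall x y, G (x, y) -> c x <> c y.

Definition homomorphism (X Y : Type) (R : set (X * X)) (S : set (Y * Y))
    (phi : X -> Y) : Prop :=
  forall x x', R (x, x') -> S (phi x, phi x').

Definition clique (X : Type) (R : set (X * X)) (Y : set X) : Prop :=
  forall x y, Y x -> Y y -> x <> y -> R (x, y).

Definition concat (t : seq bool) (c : cantor_space) : cantor_space :=
  fun n => nth (c (n - size t)) t n.

Definition G0 (s : forall n, n.-tuple bool) : set (cantor_space * cantor_space) :=
  [set p | exists (c : cantor_space) (n : nat),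
     p = (concat (s n) (concat [:: false] c),
          concat (s n) (concat [:: true] c))].

(* Main.v *)
(* Let Y be an R-clique on which G is not countably colorable.  Call a subset Z
   of Y large if G is countably colorable on the rest of Y; large sets are closed
   under countable intersections.  A configuration of level n attaches a point of
   Z to each binary sequence of length n and codes in the Baire space witnessing
   that the G_0-edges of level n are sent into G.  There are only countably many
   finite approximations of configurations, so some large Z is such that every
   approximation realized in Z is realized in all large sets.  The points sitting
   at s_n in the configurations of Z with a given approximation are then never
   G-independent (otherwise they could be removed from Z), and two configurations
   joined by a G-edge at s_n glue to one of level n + 1 with the same
   approximation.  Iterating with finer and finer approximations gives phi in the
   limit.  Since the points of each configuration lie in the clique Y, the
   approximation of level n can be chosen so fine that all pairs of points it
   allows lie in U_n, where R is the intersection of the open sets U_n. *)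
Require Import Defs.
From mathcomp Require Import all_boot.
From mathcomp Require Import all_classical.
From mathcomp Require Import topology borel_hierarchy cantor.

Local Open Scope classical_set_scope.

(** * Codes for analytic sets *)

Definition agree {T : Type} (K : nat) (x y : nat -> T) : Prop :=
  forall i, i < K -> x i = y i.

Lemma nbhs_agree (z : baire_space) (A : set baire_space) :
  nbhs z A -> exists K, forall y, agree K z y -> A y.
Proof.
pose F : set_system {ptws nat -> nat} :=
  filter_from [set: nat] (fun K => [set y | agree K z y]).
have FF : Filter F.
  apply: filter_from_filter; first by exists 0.
  move=> K L _ _; exists (maxn K L) => // y zy; split=> i ltiK; apply: zy;
    by rewrite leq_max ltiK ?orbT.
have : F --> (z : {ptws nat -> nat}).
  apply/pointwise_cvgP => i U zU; exists i.+1 => // y zy.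
  by rewrite /= -zy//; exact: nbhs_singleton.
by move=> /[apply] -[K _ KA]; exists K.
Qed.

Lemma cantor_nbhs_agree (c : cantor_space) (n : nat) :
  nbhs c [set d | agree n c d].
Proof.
elim: n => [|n IH]; first by apply: filterS filterT.
have cn : nbhs c ((proj n : cantor_space -> bool) @^-1` [set c n]).
  exact/proj_continuous/discrete_set1.
apply: filterS2 IH cn => d cd dn i; rewrite ltnS leq_eqVlt => /predU1P[->//|].
exact: cd.
Qed.

Definition code_closed (C : set (nat -> nat)) : Prop :=
  forall z, (forall K, exists2 y, C y & agree K z y) -> C z.

Definition code_continuous {T : topologicalType} (C : set (nat -> nat))
    (F : (nat -> nat) -> T) : Prop :=
  forall z, C z -> forall U, nbhs (F z) U ->
    exists K, forall y, C y -> agree K z y -> U (F y).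

Lemma analytic_code {X : topologicalType} {G : set (X * X)} :
  analytic_relation G -> G !=set0 ->
  exists (C : set (nat -> nat)) (F : (nat -> nat) -> X * X),
    [/\ code_closed C, code_continuous C F & F @` C = G].
Proof.
move=> [C [f [clC ctf ranf]]] [p0 Gp0].
(* The value [p0] outside [C] is junk; it makes [F] total and is available because [G] is
   nonempty. *)
pose F (z : nat -> nat) : X * X :=
  if pselect (C z) is left Cz then set_val (f (SigSub (mem_set Cz))) else p0.
have FE (z : nat -> nat) (Cz : z \in (C : set baire_space)) : F z = set_val (f (SigSub Cz)).
  rewrite /F; case: pselect => [Cz'|]; last by move/(_ (set_mem Cz)).
  by rewrite (bool_irrelevance (mem_set Cz') Cz).
exists C, F; split.
- move=> z zC; apply: clC => B /nbhs_agree[K KB].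
  by have [y Cy zy] := zC K; exists y; split=> //; exact: KB.
- move=> z Cz U; rewrite (FE z (mem_set Cz)) => FzU.
  have /ctf : nbhs (f (SigSub (mem_set Cz))) (set_val @^-1` U).
    exact: initial_continuous FzU.
  rewrite nbhs_simpl /= => -[_ [[W oW <-] /= Wz WU]].
  have [|K KW] := @nbhs_agree z W; first exact: open_nbhs_nbhs.
  exists K => y Cy zy; rewrite (FE y (mem_set Cy)).
  by apply: (WU (SigSub (mem_set Cy))); exact: KW.
- rewrite eqEsubset; split=> [p [z Cz <-]|p Gp].
    by rewrite (FE z (mem_set Cz)); exact: set_valP.
  have : range f (SigSub (mem_set Gp)) by rewrite ranf.
  case=> [[z Cz]] _ fz; exists z; first exact: set_mem.
  by rewrite (FE z Cz) fz.
Qed.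

Definition shift (z : nat -> nat) : nat -> nat := fun i => z i.+1.

(* The first entry of a code selects the endpoint of the edge coded by the
   remaining ones. *)
Definition endpoint {X : Type} (F : (nat -> nat) -> X * X) (z : nat -> nat) :=
  if z 0 == 0 then (F (shift z)).1 else (F (shift z)).2.

Lemma code_endpoint {X : topologicalType} (C : set (nat -> nat))
    (F : (nat -> nat) -> X * X) :
  code_closed C -> code_continuous C F ->
  code_closed (shift @^-1` C) /\
  code_continuous (shift @^-1` C) (endpoint F).
Proof.
move=> clC ctF; split=> [z zC|z Cz V nV].
  apply: clC => K; have [y Cy zy] := zC K.+1; exists (shift y) => // i iK.
  exact: zy.
pose W := [set p : X * X | V (if z 0 == 0 then p.1 else p.2)].
have nW : nbhs (F (shift z)) W.
  rewrite /W; move: nV; rewrite /endpoint; case: (z 0 == 0) => nV.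
    exact: cvg_fst.
  exact: cvg_snd.
(* Agreement up to [K.+1] fixes the selecting entry and leaves agreement up to [K] after the
   shift. *)
have [K KP] := ctF _ Cz _ nW; exists K.+1 => y Cy zy.
rewrite /endpoint -zy//; apply: KP => // i iK; exact: zy.
Qed.

(** * Countable colorability and large sets *)

Definition countably_colorable {X : Type} (G : set (X * X)) (A : set X) : Prop :=
  exists c : X -> nat, forall x y, A x -> A y -> G (x, y) -> c x <> c y.

Lemma countably_colorableS {X : Type} (G : set (X * X)) (A B : set X) :
  A `<=` B -> countably_colorable G B -> countably_colorable G A.
Proof. by move=> AB [c cP]; exists c => x y /AB Bx /AB; exact: cP. Qed.

Lemma independent_colorable {X : Type} (G : set (X * X)) (A : set X) :
  (forall x y, A x -> A y -> ~ G (x, y)) -> countably_colorable G A.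
Proof. by move=> indA; exists (fun=> 0) => x y Ax Ay /(indA x y Ax Ay). Qed.

Lemma countably_colorable_bigcup {X : Type} (G : set (X * X))
    (A : nat -> set X) :
  (forall i, countably_colorable G (A i)) ->
  countably_colorable G (\bigcup_i A i).
Proof.
move=> /choice[c cP].
have /choice[i iP] (x : X) : exists i, (\bigcup_i A i) x -> A i x.
  have [[i _ Ai]|] := pselect ((\bigcup_i A i) x); first by exists i.
  by exists 0.
(* A point is colored by the index of a piece containing it, paired with its color there. *)
exists (fun x => pickle (i x, c (i x) x)) => x y Ux Uy Gxy.
move/(pcan_inj pickleK) => -[ixy].
by rewrite -ixy; apply: cP Gxy; [exact: iP|rewrite ixy; exact: iP].
Qed.

Lemma countably_colorableU {X : Type} (G : set (X * X)) (A B : set X) :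
  countably_colorable G A -> countably_colorable G B ->
  countably_colorable G (A `|` B).
Proof.
move=> cA cB.
have cAB i : countably_colorable G (if i == 0 then A else B) by case: ifP.
apply: countably_colorableS (countably_colorable_bigcup G _ cAB).
by move=> x [Ax|Bx]; [exists 0|exists 1].
Qed.

Lemma restriction_coloring {X : Type} (G : set (X * X)) (Y : set X) :
  countably_colorable G Y ->
  exists c : Y -> nat, coloring (restriction G Y) c.
Proof.
move=> [c cP]; exists (fun y => c (val y)) => x y /=.
by apply: cP; exact: set_valP.
Qed.

(** These are the large subsets of [Y]. *)
Definition co_colorable {X : Type} (G : set (X * X)) (Y Z : set X) : Prop :=
  Z `<=` Y /\ countably_colorable G (Y `\` Z).

Lemma co_colorable_bigcap {X : Type} (G : set (X * X)) (Y : set X)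
    (Z : nat -> set X) :
  (forall i, co_colorable G Y (Z i)) -> co_colorable G Y (\bigcap_i Z i).
Proof.
move=> ccZ; split=> [x Zx|]; first by apply: (ccZ 0).1; exact: Zx.
rewrite setDE setC_bigcap setI_bigcupr.
by apply: countably_colorable_bigcup => i; rewrite -setDE; exact: (ccZ i).2.
Qed.

Lemma co_colorableD {X : Type} (G : set (X * X)) (Y Z A : set X) :
  co_colorable G Y Z -> countably_colorable G A ->
  co_colorable G Y (Z `\` A).
Proof.
move=> [ZY cYZ] cA; split=> [x [/ZY]//|].
apply: countably_colorableS (countably_colorableU G _ _ cYZ cA) => x [Yx nZAx].
have [Ax|nAx] := pselect (A x); [by right|left; split=> // Zx].
exact: nZAx.
Qed.

(* Fewer properties survive on a smaller set, and only countably many can be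
   destroyed. *)
Lemma exists_stable {X : Type} (I : countType) (F : set (set X))
    (Q : I -> set X -> Prop) :
  F !=set0 -> (forall Z : nat -> set X, (forall i, F (Z i)) -> F (\bigcap_i Z i)) ->
  (forall i Z Z', Z `<=` Z' -> Q i Z -> Q i Z') ->
  exists2 Z, F Z & forall i, Q i Z -> forall Z', F Z' -> Q i Z'.
Proof.
move=> [Z0 FZ0] Fcap Qmono.
have /choice[Z ZP] (m : nat) : exists Z, F Z /\
    forall i : I, pickle i = m -> Q i Z -> forall Z', F Z' -> Q i Z'.
  case: (pselect (exists i : I, exists2 Z, pickle i = m & F Z /\ ~ Q i Z)).
    move=> [i [Z im [FZ nQZ]]]; exists Z; split=> // j.
    by rewrite -im => /(pcan_inj pickleK) ->.
  move=> nex; exists Z0; split=> // i im _ Z' FZ'.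
  by apply: contrapT => nQ; apply: nex; exists i, Z'.
exists (\bigcap_m Z m); first by apply: Fcap => m; exact: (ZP m).1.
move=> i Qi; apply: (ZP (pickle i)).2 => //.
by apply: Qmono Qi => x; exact.
Qed.

Lemma dependent_choice_nat {T : Type} (I : nat -> T -> Prop)
    (R : nat -> T -> T -> Prop) :
  (exists x, I 0 x) ->
  (forall n x, I n x -> exists2 y, I n.+1 y & R n x y) ->
  exists u : nat -> T, forall n, I n (u n) /\ R n (u n) (u n.+1).
Proof.
move=> [x0 Ix0] step.
(* States carry their stage, because [dependent_choice] iterates one fixed relation. *)
pose S := {p : nat * T | I p.1 p.2}.
pose RS (p q : S) := (sval q).1 = (sval p).1.+1 /\
                     R (sval p).1 (sval p).2 (sval q).2.
have RSP (p : S) : {q : S | RS p q}.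
  apply: cid; case: p => -[n x] /= Inx; have [y Iy Rxy] := step n x Inx.
  by exists (exist _ (n.+1, y) Iy).
have [u [u0 uS]] := dependent_choice RSP (exist _ (0, x0) Ix0).
have un n : (sval (u n)).1 = n.
  by elim: n => [|n IH]; [rewrite u0|rewrite (uS n).1 IH].
exists (fun n => (sval (u n)).2) => n; split; first by rewrite -{1}(un n); case: (u n).
by rewrite -{1}(un n); exact: (uS n).2.
Qed.

Lemma mkseq_concat (t : seq bool) (c : cantor_space) (m : nat) :
  mkseq (concat t c) (size t + m) = t ++ mkseq c m.
Proof.
apply: (@eq_from_nth _ false); first by rewrite size_cat !size_mkseq.
move=> i; rewrite size_mkseq => ilt; rewrite nth_mkseq// nth_cat /concat.
case: ltnP => [it|ti]; first exact: set_nth_default.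
by rewrite nth_default// nth_mkseq// ltn_subLR.
Qed.

(** * Finite configurations *)

Section Configurations.
Context {X : topologicalType} (s : forall n, n.-tuple bool).
Context (C D : set (nat -> nat)) (F : (nat -> nat) -> X * X).
Context (P : (nat -> nat) -> X).

(* [f t 0] codes the point attached to t.  If [t = s k ++ false :: t'], then
   [f t k.+1] codes the edge from that point to the one at [s k ++ true :: t'];
   the other values of [f] are junk. *)
Definition config := seq bool -> nat -> nat -> nat.

(** As [s k] has length [k], the equation [k + (size t).+1 = n] makes both ends of the edge
    sequences of length [n]. *)
Definition is_config (Z : set X) (n : nat) (f : config) : Prop :=
  (forall t, size t = n -> D (f t 0) /\ Z (P (f t 0))) /\
  (forall k t, k + (size t).+1 = n ->
     C (f (s k ++ false :: t) k.+1) /\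
     F (f (s k ++ false :: t) k.+1) =
       (P (f (s k ++ false :: t) 0), P (f (s k ++ true :: t) 0))).

Lemma is_configS (Z Z' : set X) (n : nat) (f : config) :
  Z `<=` Z' -> is_config Z n f -> is_config Z' n f.
Proof. by move=> ZZ' [fp fe]; split=> // t /fp[? /ZZ']. Qed.

(** The table is finite, so pickling leaves only countably many approximations. Slots up to [n]
    suffice, since edges of level [n] have [k < n]. *)
Definition approx (n K : nat) (f : config) : nat :=
  pickle [ffun p : n.-tuple bool * 'I_n.+1 * 'I_K => f p.1.1 p.1.2 p.2].

Lemma approx_agree (n K : nat) (f g : config) (t : seq bool) (j : nat) :
  approx n K f = approx n K g -> size t = n -> j <= n ->
  agree K (f t j) (g t j).
Proof.
move=> /(pcan_inj pickleK)/ffunP fg /eqP tn jn i iK.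
by have := fg (Tuple tn, Ordinal (jn : j < n.+1), Ordinal iK); rewrite !ffunE.
Qed.

Definition stable (G : set (X * X)) (Y Z : set X) : Prop :=
  forall n K f, is_config Z n f -> forall Z', co_colorable G Y Z' ->
    exists2 g, is_config Z' n g & approx n K g = approx n K f.

Lemma exists_stable_co_colorable (G : set (X * X)) (Y : set X) :
  exists2 Z, co_colorable G Y Z & stable G Y Z.
Proof.
pose Q (p : nat * nat * nat) Z :=
  exists2 f, is_config Z p.1.1 f & approx p.1.1 p.1.2 f = p.2.
have [||p Z Z' ZZ' [f cf fp]|Z YZ stZ] :=
  @exists_stable X (nat * nat * nat)%type (co_colorable G Y) Q.
- exists Y; split=> //; apply: independent_colorable => x y.
  by rewrite setDv.
- exact: co_colorable_bigcap.
- by exists f => //; exact: is_configS cf.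
- exists Z => // n K f cf Z' YZ'.
  by apply: (stZ (n, K, approx n K f)) YZ'; exists f.
Qed.

Lemma config_extend (G : set (X * X)) (Y Z : set X) (n K : nat) (f : config) :
  G `<=` F @` C -> co_colorable G Y Z -> stable G Y Z -> is_config Z n f ->
  exists2 g, is_config Z n.+1 g &
    forall t b j, size t = n -> j <= n -> agree K (f t j) (g (rcons t b) j).
Proof.
move=> GF YZ stZ cf.
pose E := [set g | is_config Z n g /\ approx n K g = approx n K f].
have [f0 [f1 [[cf0 ff0] [cf1 ff1] Gf]]] : exists f0 f1,
    [/\ E f0, E f1 & G (P (f0 (s n) 0), P (f1 (s n) 0))].
  (* Were the points at [s n] independent, deleting them from [Z] would leave a large set. Stability
     would realize the approximation there, by a configuration whose point at [s n] has been
     deleted. *)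
  apply: contrapT => nex.
  have cA : countably_colorable G [set P (g (s n) 0) | g in E].
    apply: independent_colorable => _ _ [f0 Ef0 <-] [f1 Ef1 <-] Gf.
    by apply: nex; exists f0, f1.
  have [g cg gf] := stZ n K f cf _ (co_colorableD _ _ _ _ YZ cA).
  have [_ [_]] := cg.1 (s n) (size_tuple _); apply; exists g => //; split=> //.
  by apply: is_configS cg => x [].
have [w Cw Fw] := GF _ Gf.
pose h (b : bool) := if b then f1 else f0.
have ch b : is_config Z n (h b) by case: b.
have hf b : approx n K f = approx n K (h b) by case: b.
(* The last bit selects which configuration to copy; the free slot [n.+1] over [s n] receives the
   code [w] of the new edge. *)
pose g (u : seq bool) (j : nat) :=
  if (take n u == s n) && (j == n.+1) then w else h (nth false u n) (take n u) j.
have gE t b j : size t = n ->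
    g (rcons t b) j = if (t == s n) && (j == n.+1) then w else h b t j.
  move=> tn; rewrite /g -cats1 take_size_cat// nth_cat tn ltnn subnn /=.
  by [].
have gh t b j : size t = n -> j <= n -> g (rcons t b) j = h b t j.
  by move=> tn jn; rewrite gE// ltn_eqF ?andbF.
exists g; last by move=> t b j tn jn; rewrite gh//; exact: approx_agree.
split=> [u|k u].
  case/lastP: u => // t b; rewrite size_rcons => -[tn].
  by rewrite gh//; exact: (ch b).1.
(* An empty tail means [k = n], the new edge; a tail ending in [b] gives an edge already present in
   [h b]. *)
case/lastP: u => [|t b].
  by rewrite addn1 => -[->]; rewrite !cats1 !gE ?size_tuple// !eqxx.
rewrite size_rcons addnS => -[kn].
rewrite -!rcons_cons -!rcons_cat.
have kt c : size (s k ++ c :: t) = n by rewrite size_cat size_tuple.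
have ltkn : k < n by rewrite -kn addnS ltnS leq_addr.
by rewrite !gh//; exact: (ch b).2.
Qed.

(** All codes close to those of [f] are included, so that limit codes inherit membership in [U]. *)
Definition controls (U : set (X * X)) (n K : nat) (f : config) : Prop :=
  forall t t' z z', size t = n -> size t' = n -> D z -> D z' ->
    agree K (f t 0) z -> agree K (f t' 0) z' -> U (P z, P z').

(** Openness of [U] gives a depth for each of the finitely many pairs of sequences; the maximum of
    these and [m] works. *)
Lemma exists_controls (U : set (X * X)) (n m : nat) (f : config) :
  code_continuous D P -> open U ->
  (forall t, size t = n -> D (f t 0)) ->
  (forall t t', size t = n -> size t' = n -> U (P (f t 0), P (f t' 0))) ->
  exists2 K, m <= K & controls U n K f.
Proof.
move=> ctP oU fD fU.
have /choice[K KP] (p : n.-tuple bool * n.-tuple bool) : exists K,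
    forall z z', D z -> D z' -> agree K (f p.1 0) z -> agree K (f p.2 0) z' ->
    U (P z, P z').
  have p1 := size_tuple p.1; have p2 := size_tuple p.2.
  have : nbhs (P (f p.1 0), P (f p.2 0)) U.
    by apply: open_nbhs_nbhs; split=> //; exact: fU.
  move=> [[A B] /= [nA nB] ABU].
  have [K1 K1P] := ctP _ (fD _ p1) _ nA; have [K2 K2P] := ctP _ (fD _ p2) _ nB.
  exists (maxn K1 K2) => z z' Dz Dz' pz pz'; apply: ABU; split=> /=.
    by apply: K1P => // i iK; apply: pz; rewrite leq_max iK.
  by apply: K2P => // i iK; apply: pz'; rewrite leq_max iK orbT.
exists (maxn m (\max_p K p)); first exact: leq_maxl.
move=> t t' z z' /eqP tn /eqP tn' Dz Dz' tz tz'.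
apply: (KP (Tuple tn, Tuple tn')) => // i iK; [apply: tz|apply: tz'];
  by rewrite leq_max (leq_trans iK (leq_bigmax _)) orbT.
Qed.

End Configurations.

(** * Limits of configurations *)

Section Limit.
Context (f : nat -> config) (K : nat -> nat).
Context (leK : forall n, n <= K n) (homoK : forall n, K n <= K n.+1).
Context (fS : forall n t b j, size t = n -> j <= n ->
  agree (K n) (f n t j) (f n.+1 (rcons t b) j)).

(** Level [maxn j i.+1] is late enough: slot [j] is preserved from level [j] on, and [n <= K n] puts
    entry [i] within the precision reached. *)
Definition limit_config (c : cantor_space) (j i : nat) : nat :=
  f (maxn j i.+1) (mkseq c (maxn j i.+1)) j i.

Lemma limit_configP (c : cantor_space) (n j : nat) :
  j <= n -> agree (K n) (f n (mkseq c n) j) (limit_config c j).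
Proof.
(* Along the branch [c], an entry within the precision of level [m] never changes again. *)
have stab m d i : j <= m -> i < K m ->
    f (m + d) (mkseq c (m + d)) j i = f m (mkseq c m) j i.
  move=> jm iK; elim: d => [|d IH]; first by rewrite addn0.
  rewrite -IH addnS mkseqS [RHS](@fS _ _ (c (m + d))) ?size_mkseq//.
    by rewrite (leq_trans jm)// leq_addr.
  elim: d {IH} => [|d IH]; first by rewrite addn0.
  by rewrite addnS (leq_trans IH).
move=> jn i iK; rewrite /limit_config; set N := maxn j i.+1.
have jN : j <= N by rewrite leq_maxl.
have iN : i < K N by rewrite (leq_trans _ (leK N))// leq_maxr.
by case: (leqP n N) => [|/ltnW] le; rewrite -(subnKC le) stab.
Qed.

End Limit.

(** Common values come arbitrarily close to both points, so no neighborhoods separate them. This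
    carries the edge equations to the limit. *)
Lemma code_limit_unique {X : topologicalType} (C D : set (nat -> nat))
    (A B : (nat -> nat) -> X) (z w : nat -> nat) :
  hausdorff_space X -> code_continuous C A -> code_continuous D B ->
  C z -> D w ->
  (forall K, exists z' w',
     [/\ C z', D w', agree K z z', agree K w w' & A z' = B w']) ->
  A z = B w.
Proof.
move=> hX ctA ctB Cz Dw app; apply: hX => U V Uz Vw.
have [K1 K1P] := ctA _ Cz _ Uz; have [K2 K2P] := ctB _ Dw _ Vw.
have [z' [w' [Cz' Dw' zz' ww' AB]]] := app (maxn K1 K2).
exists (A z'); split.
  by apply: K1P => // i iK; apply: zz'; rewrite leq_max iK.
by rewrite AB; apply: K2P => // i iK; apply: ww'; rewrite leq_max iK orbT.
Qed.

Lemma agree_sym {T : Type} {n : nat} {x y : nat -> T} :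
  agree n x y -> agree n y x.
Proof. by move=> xy i /xy. Qed.

Lemma agreeW {T : Type} {m n : nat} {x y : nat -> T} :
  m <= n -> agree n x y -> agree m x y.
Proof. by move=> mn xy i im; apply: xy; exact: leq_trans mn. Qed.

(** * Construction of the homomorphism *)

Lemma exists_homomorphism {X : topologicalType} (s : forall n, n.-tuple bool)
    (G : set (X * X)) (U : nat -> set (X * X))
    (C D : set (nat -> nat)) (F : (nat -> nat) -> X * X)
    (P : (nat -> nat) -> X) (Y : set X) :
  hausdorff_space X ->
  code_closed C -> code_continuous C F -> F @` C = G ->
  code_closed D -> code_continuous D P -> Y `<=` P @` D ->
  (forall n, open (U n)) -> (forall n x y, Y x -> Y y -> U n (x, y)) ->
  ~ countably_colorable G Y ->
  exists phi : cantor_space -> X,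
    [/\ continuous phi, homomorphism (G0 s) G phi &
        forall n c d, U n (phi c, phi d)].
Proof.
move=> hX clC ctF FG clD ctP YP oU YU ncY.
have [Z [ZY cYZ] stZ] := exists_stable_co_colorable s C D F P G Y.
have ctF1 : code_continuous C (fst \o F).
  by move=> z Cz V nV; have := ctF z Cz (fst @^-1` V); apply; exact: cvg_fst.
have ctF2 : code_continuous C (snd \o F).
  by move=> z Cz V nV; have := ctF z Cz (snd @^-1` V); apply; exact: cvg_snd.
pose conf := is_config s C D F P Z.
pose I n (p : config * nat) :=
  [/\ conf n p.1, n <= p.2 & controls D P (U n) n p.2 p.1].
pose S n (p q : config * nat) := p.2 <= q.2 /\
  forall t b j, size t = n -> j <= n ->
    agree p.2 (p.1 t j) (q.1 (rcons t b) j).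
have control n m f : conf n f ->
    exists2 K, m <= K & controls D P (U n) n K f.
  move=> cf; apply: exists_controls => // [t /cf.1[]//|t t' tn tn'].
  by apply: YU; apply: ZY; [exact: (cf.1 t tn).2|exact: (cf.1 t' tn').2].
have [|n [f K] [/= cf nK _]|u uP] := @dependent_choice_nat _ I S.
(* At level 0 there are no edges, so one point of [Z] is a configuration; [Z] is nonempty because
   [Y] is not countably colorable. *)
- have [x Zx] : Z !=set0.
    apply: contrapT => Z0; apply: ncY; apply: countably_colorableS cYZ.
    by move=> y Yy; split=> // Zy; apply: Z0; exists y.
  have [z Dz zx] := YP _ (ZY _ Zx).
  have cf : conf 0 (fun _ _ => z).
    by split=> [t _|k t]; rewrite ?zx// addnS.
  by have [K K0 KP] := control 0 0 _ cf; exists (fun _ _ => z, K).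
- have GF : G `<=` F @` C by rewrite FG.
  have [g cg fg] := @config_extend _ s _ D _ P _ _ _ n K f GF (conj ZY cYZ) stZ cf.
  (* The bound keeps the precision nondecreasing and at least the level. *)
  have [L nKL LP] := control n.+1 (maxn K n.+1) _ cg.
  move: nKL; rewrite geq_max => /andP[KL nL].
  by exists (g, L).
pose f n := (u n).1; pose K n := (u n).2.
have cf n : conf n (f n) by have [[]] := uP n.
have leK n : n <= K n by have [[]] := uP n.
have ctl n : controls D P (U n) n (K n) (f n) by have [[]] := uP n.
have homoK n : K n <= K n.+1 by have [_ []] := uP n.
have fS n : forall t b j, size t = n -> j <= n ->
    agree (K n) (f n t j) (f n.+1 (rcons t b) j) by have [_ []] := uP n.
pose L := limit_config f.
have LP c n j : j <= n -> agree (K n) (f n (mkseq c n) j) (L c j).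
  exact: limit_configP.
have DL c : D (L c 0).
  apply: clD => k; exists (f k (mkseq c k) 0).
    by have [] := (cf k).1 (mkseq c k) (size_mkseq _ _).
  exact: agree_sym (agreeW (leK k) (LP c k 0 (leq0n k))).
exists (fun c => P (L c 0)); split.
- move=> c V nV; have [k kP] := ctP _ (DL c) _ nV.
  apply: filterS (cantor_nbhs_agree c k) => d cd; apply: kP => //.
  have cdk : mkseq c k = mkseq d k.
    by apply/eq_in_map => i; rewrite mem_iota => /andP[_]; exact: cd.
  move=> i ik; have iK := leq_trans ik (leK k).
  by rewrite -(LP c k 0 _ i iK)// -(LP d k 0 _ i iK)// cdk.
- move=> _ _ [c [k [-> ->]]].
  set c0 := concat _ _; set c1 := concat (s k) (concat [:: true] c).
  (* At every level beyond [k], the prefixes of [c0] and [c1] form an edge coded in slot [k.+1]. *)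
  have edge m (n := k + m.+1) (t := mkseq c m) :
    [/\ mkseq c0 n = s k ++ false :: t, mkseq c1 n = s k ++ true :: t
      & k + (size t).+1 = n].
    have E b : mkseq (concat (s k) (concat [:: b] c)) n = s k ++ b :: t.
      rewrite /n -[X in mkseq _ (X + _)](size_tuple (s k)) mkseq_concat.
      by rewrite -add1n (mkseq_concat [:: b]).
    by split; [exact: E|exact: E|rewrite size_mkseq].
  have CF m : exists n, [/\ m <= n, k < n, C (f n (mkseq c0 n) k.+1) &
      F (f n (mkseq c0 n) k.+1) = (P (f n (mkseq c0 n) 0), P (f n (mkseq c1 n) 0))].
    exists (k + m.+1); have [-> -> kn] := edge m.
    have [] := (cf (k + m.+1)).2 _ _ kn; split=> //.
      by rewrite addnS -addSn leq_addl.
    by rewrite addnS ltnS leq_addr.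
  have Df n b : D (f n (mkseq b n) 0).
    by have [] := (cf n).1 (mkseq b n) (size_mkseq _ _).
  have near m n j b : j <= n -> m <= n -> agree m (L b j) (f n (mkseq b n) j).
    move=> jn mn; apply: agree_sym; apply: agreeW (LP b n j jn).
    exact: leq_trans (leK n).
  have CL : C (L c0 k.+1).
    apply: clC => m; have [n [mn kn Cn _]] := CF m.
    by exists (f n (mkseq c0 n) k.+1) => //; exact: near.
  rewrite -FG; exists (L c0 k.+1) => //.
  (* At infinitely many levels the coordinates of the coded edge are the points coded in slot 0;
     each equality passes to the limit separately. *)
  rewrite [LHS]surjective_pairing; congr (_, _).
    apply: (code_limit_unique C D (fst \o F) P) => // m.
    have [n [mn kn Cn Fn]] := CF m.
    exists (f n (mkseq c0 n) k.+1), (f n (mkseq c0 n) 0).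
    by rewrite /= Fn; split=> //; exact: near.
  apply: (code_limit_unique C D (snd \o F) P) => // m.
  have [n [mn kn Cn Fn]] := CF m.
  exists (f n (mkseq c0 n) k.+1), (f n (mkseq c1 n) 0).
  by rewrite /= Fn; split=> //; exact: near.
- by move=> n c d; apply: (ctl n (mkseq c n) (mkseq d n));
    rewrite ?size_mkseq//; exact: LP.
Qed.

Theorem theorem1p1 (s : forall n, n.-tuple bool)
    (hs : forall t : seq bool, exists n, prefix t (s n))
    (X : topologicalType) (hX : hausdorff_space X)
    (G : set (X * X)) (hG : digraph G) (hGa : analytic_relation G)
    (R : set (X * X)) (hR : reflexive_relation R) (hRd : Gdelta R) :
  (forall Y : set X, clique R Y ->
     exists c : Y -> nat, coloring (restriction G Y) c) \/
  (exists phi : cantor_space -> X,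
     [/\ continuous phi, homomorphism (G0 s) G phi & clique R (range phi)]).
Proof.
apply: contrapT => /not_orP[/existsNP[Y /not_implyP[cY ncY]]]; apply.
(* Only points incident with an edge have codes; the other points of [Y] are independent and cost
   one color. *)
pose Y' := [set x | Y x /\ exists y, G (x, y) \/ G (y, x)].
have ncY' : ~ countably_colorable G Y'.
  move=> cY'; apply: ncY; apply: restriction_coloring.
  have cN : countably_colorable G (Y `\` Y').
    apply: independent_colorable => x y [Yx nY'x] [Yy _] Gxy.
    by apply: nY'x; split=> //; exists y; left.
  apply: countably_colorableS (countably_colorableU G _ _ cY' cN) => x Yx.
  by have [Y'x|nY'x] := pselect (Y' x); [left|right].
have G0 : G !=set0.
  apply: contrapT => G0; apply: ncY'; apply: independent_colorable => x y _ _ Gxy.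
  by apply: G0; exists (x, y).
have [C [F [clC ctF FG]]] := analytic_code hGa G0.
have [clD ctP] := code_endpoint C F clC ctF.
have [U oU RU] := hRd.
have [|n x y [Yx _] [Yy _]|phi [cphi hphi Uphi]] :=
  exists_homomorphism s G U _ _ _ _ Y' hX clC ctF FG clD ctP _ oU _ ncY'.
- move=> x [_ [y [Gxy|Gyx]]].
    have [z Cz Fz] : (F @` C) (x, y) by rewrite FG.
    by exists (fun i => if i is i'.+1 then z i' else 0); rewrite /endpoint /= ?Fz.
  have [z Cz Fz] : (F @` C) (y, x) by rewrite FG.
  by exists (fun i => if i is i'.+1 then z i' else 1); rewrite /endpoint /= ?Fz.
(* Points of a configuration may coincide, so diagonal pairs must lie in each [U n] too; reflexivity
   provides them. *)
- have : R (x, y) by have [->|/eqP xy] := eqVneq x y; [exact: hR|exact: cY].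
  by rewrite RU; exact.
- exists phi; split=> // _ _ [c _ <-] [d _ <-] _; rewrite RU => n _; exact: Uphi.
Qed.
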